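(* Let $k\ge 2$ and $l\ge\frac{2k^{2}}{\ln k}$ be integers. There is no protocol consisting of two public announcements (modeled in Dynamic Epistemic Logic as described in the context) that solves the generalized Russian Cards Problem RCP$(k;l)$.
   Context: In RCP$(k;l)$ the cards are $U=\{1,\dots,2k+l\}$ and the players are Anne ($a$), Bill ($b$), Cath ($c$). A deal is a triple $(A,B,C)$ of pairwise disjoint subsets of $U$ with $|A|=|B|=k$, $|C|=l$ and $A\cup B\cup C=U$; $A,B,C$ are the hands of Anne, Bill and Cath. The initial Kripke model has as states all deals, and for each player $n\in\{a,b,c\}$ an equivalence relation $\sim_n$ (indistinguishability), where $(A,B,C)\sim_a(A',B',C')$ iff $A=A'$, $(A,B,C)\sim_b(A',B',C')$ iff $B=B'$, and $(A,B,C)\sim_c(A',B',C')$ iff $C=C'$; the valuation makes the atom ''card $i$ is with player $n$'' true at a deal exactly when $i$ is in $n$'s hand. Agents know a formula at a state iff it holds at all states indistinguishable to them from that state. A public announcement by a player $x$ in a current model (set of states $W$ with relations $\sim_a,\sim_b,\sim_c$) is a deterministic choice of message depending only on $x$'s knowledge, i.e. a function $f$ from $W$ to a set of messages with $f(w)=f(w')$ whenever $w\sim_x w'$; its effect is the DEL product update with the public action model whose actions are the messages (each agent distinguishes distinct messages) and whose preconditions are the sets of states where the respective message is made, so that afterwards $w\sim'_n w'$ iff $w\sim_n w'$ and $f(w)=f(w')$. A protocol is a finite sequence of such announcements, each made by some player and applied to the model resulting from the previous ones. The protocol solves the problem iff in the final model, for every deal $w=(A,B,C)$: (i) the only state Anne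 cannot distinguish from $w$ is $w$ itself, and likewise for Bill (so both know the whole deal); and (ii) for every card $x\notin C$ there are states $(A',B',C')$ and $(A'',B'',C'')$ indistinguishable for Cath from $w$ with $x\in A'$ and $x\in B''$ (so Cath does not learn who holds any card other than her own).
   Formalization: The two announcements are required to be made by Anne or Bill (in any order, possibly the same player twice), never by Cath: if Cath may speak, she can announce her hand, another player a constant, and the problem is solved. *)

(* Defs.v *)
From mathcomp Require Import all_boot all_order all_algebra.
From mathcomp Require Import reals exp.

Set Implicit Arguments.
Unset Strict Implicit.
Unset Printing Implicit Defensive.

Inductive player : Set := Anne | Bill | Cath.

(* [holds s n i] is the truth value at [s] of the atom "card i is with player n". *)
Record kripke (card : Type) : Type := Kripke {
  state : Type;
  indist : player -> state -> state -> Prop;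
  holds : state -> player -> card -> Prop
}.

(* Preconditions are given semantically, as sets of states of [M]. *)
Record action_model (card : Type) (M : kripke card) : Type := ActionModel {
  action : Type;
  action_indist : player -> action -> action -> Prop;
  pre : action -> state M -> Prop
}.

Definition product_update (card : Type) (M : kripke card)
    (E : action_model M) : kripke card :=
  @Kripke card
    {s : state M * action E | pre s.2 s.1}
    (fun n s t => indist n (sval s).1 (sval t).1 /\
                  action_indist n (sval s).2 (sval t).2)
    (fun s n i => holds (sval s).1 n i).

Record announcement (card : Type) (M : kripke card) : Type := Announcement {
  speaker : player;
  message : Type;
  announce : state M -> message;
  announce_known : forall s t : state M,
    indist speaker s t -> announce s = announce t
}.

Definition announcement_action (card : Type) (M : kripke card)
    (f : announcement M) : action_model M :=
  @ActionModel card M (message f)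
    (fun _ m m' => m = m')
    (fun m s => announce f s = m).

Definition update (card : Type) (M : kripke card) (f : announcement M) :
  kripke card := product_update (announcement_action f).

Inductive protocol (card : Type) (M : kripke card) : Type :=
| Stop : protocol M
| Announce (f : announcement M) (p : protocol (update f)) : protocol M.

Fixpoint announcements (card : Type) (M : kripke card) (p : protocol M) : nat :=
  match p with
  | Stop => 0
  | Announce f q => (announcements q).+1
  end.

Fixpoint final_model (card : Type) (M : kripke card) (p : protocol M) :
    kripke card :=
  match p with
  | Stop => M
  | Announce f q => final_model q
  end.

(* Cath is the eavesdropper and must be required to be silent: otherwise she
   could announce her own hand, after which Anne and Bill know the whole deal
   while Cath has learnt nothing. *)
Fixpoint silent (card : Type) (n : player) (M : kripke card)
    (p : protocol M) : Prop :=
  match p with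
  | Stop => True
  | Announce f q => speaker f <> n /\ silent n q
  end.

Definition informative (card : Type) (M : kripke card) : Prop :=
  forall (n : player) (s t : state M),
    n = Anne \/ n = Bill -> indist n s t -> t = s.

Definition safe (card : Type) (M : kripke card) : Prop :=
  forall (s : state M) (i : card), ~ holds s Cath i ->
    (exists2 t : state M, indist Cath s t & holds t Anne i) /\
    (exists2 t : state M, indist Cath s t & holds t Bill i).

Definition solves (card : Type) (M : kripke card) (p : protocol M) : Prop :=
  informative (final_model p) /\ safe (final_model p).

Definition is_deal (k l : nat)
    (d : {set 'I_(2 * k + l)} * {set 'I_(2 * k + l)} * {set 'I_(2 * k + l)}) :
    bool :=
  let: (A, B, C) := d in
  [&& [disjoint A & B], [disjoint A & C], [disjoint B & C],
      #|A| == k, #|B| == k, #|C| == l & A :|: B :|: C == [set: 'I_(2 * k + l)]].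

Definition deal (k l : nat) : Type :=
  {d : {set 'I_(2 * k + l)} * {set 'I_(2 * k + l)} * {set 'I_(2 * k + l)} |
    is_deal d}.

Definition hand (k l : nat) (d : deal k l) (n : player) :
    {set 'I_(2 * k + l)} :=
  let: (A, B, C) := val d in
  match n with Anne => A | Bill => B | Cath => C end.

Definition RCP (k l : nat) : kripke 'I_(2 * k + l) :=
  @Kripke 'I_(2 * k + l) (deal k l)
    (fun n d d' => hand d n = hand d' n)
    (fun d n i => i \in hand d n).

(* Main.v *)
Require Import Defs.
From mathcomp Require Import all_boot all_order all_algebra.
From mathcomp Require Import reals exp.

(** A speaker learns nothing from her own announcement. Hence the two
    announcements come from different players among Anne and Bill, and the
    second speaker [y] already knows the whole deal after the announcement of
    the first speaker [x]. Since [l >= k], any two possible hands of [x] leave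
    at least [k] cards, so some hand of [y] is compatible with both: if they gave
    the same message, [y] could not tell them apart. So the first message reveals
    the hand of [x] to everybody, Cath included. *)

Set Implicit Arguments.
Unset Strict Implicit.
Unset Printing Implicit Defensive.

Import Order.TTheory GRing.Theory Num.Theory.
Local Open Scope ring_scope.

Definition fully_informed (card : Type) (n : player) (M : kripke card) : Prop :=
  forall s t : state M, indist n s t -> t = s.

Definition updated_state (card : Type) (M : kripke card) (f : announcement M)
    (s : state M) : state (update f) :=
  exist (fun sm : state M * message f => announce f sm.1 = sm.2)
    (s, announce f s) erefl.

(** States the speaker cannot tell apart carry the same message, so the update does not separate
    them for her. *)
Lemma fully_informed_speaker (card : Type) (M : kripke card)
    (f : announcement M) :
  fully_informed (speaker f) (update f) -> fully_informed (speaker f) M.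
Proof.
move=> inf s t st.
have /inf/(congr1 (fun u => (sval u).1)) // :
  indist (speaker f) (updated_state f s) (updated_state f t).
by split=> //=; apply: announce_known.
Qed.

(** Messages are public, so this covers Cath as well, the player for whom it is needed. *)
Lemma announce_indist_update (card : Type) (M : kripke card)
    (f : announcement M) (n : player) (s t : state (update f)) :
  indist n s t -> announce f (sval s).1 = announce f (sval t).1.
Proof. by case: s t => [[s a] /= <-] [[t b] /= <-] []. Qed.

Lemma exists_subset_card (T : finType) (A : {set T}) (n : nat) :
  (n <= #|A|)%N -> exists2 B : {set T}, B \subset A & #|B| = n.
Proof.
move=> /card_geqP[s [us ss sA]]; exists [set x in s].
  by apply/subsetP=> x; rewrite inE => /sA.
by rewrite cardsE (card_uniqP us).
Qed.

Section Deals.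
Variables k l : nat.
Implicit Types (d : deal k l) (x y : player) (H K : {set 'I_(2 * k + l)}).

Lemma disjoint_hand d x y : x <> y -> [disjoint hand d x & hand d y].
Proof.
case: d => [[[A B] C] dP]; rewrite /hand /=.
by move: dP => /= /and4P[? ? ? _]; case: x; case: y => // _; rewrite disjoint_sym.
Qed.

Lemma card_hand d x : x <> Cath -> #|hand d x| = k.
Proof.
case: d => [[[A B] C] dP]; rewrite /hand /=.
by move: dP => /= /and5P[_ _ _ /eqP ? /and3P[/eqP ? _ _]]; case: x.
Qed.

(** Cath receives the complement of [H :|: K], which has [l] elements by counting. *)
Lemma exists_deal x y H K : x <> Cath -> y <> Cath -> x <> y ->
  #|H| = k -> #|K| = k -> [disjoint H & K] ->
  exists d, hand d x = H /\ hand d y = K.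
Proof.
have mk (A B : {set _}) : #|A| = k -> #|B| = k -> [disjoint A & B] ->
    exists d, hand d Anne = A /\ hand d Bill = B.
  move=> cA cB dAB.
  have cC : #|~: (A :|: B)| = l.
    have := cardsC (A :|: B); rewrite card_ord cardsU cA cB.
    by rewrite (disjoint_setI0 dAB) cards0 subn0 addnn -mul2n => /addnI.
  suff dP : is_deal (A, B, ~: (A :|: B)) by exists (exist (@is_deal k l) _ dP).
  rewrite /is_deal /= dAB cA cB cC !eqxx setUCr eqxx !andbT /=.
  by rewrite !disjoints_subset setCK subsetUl subsetUr.
move=> xC yC xy cH cK dHK.
case: x y xC yC xy => [||] // [||] // _ _ _; first exact: mk.
by have [|d []] := mk _ _ cK cH; [rewrite disjoint_sym | exists d].
Qed.

Lemma exists_hand : exists H, #|H| = k.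
Proof.
have [|H _ cH] := @exists_subset_card _ [set: 'I_(2 * k + l)] k; last by exists H.
by rewrite cardsT card_ord mul2n -addnn -addnA leq_addr.
Qed.

(** Two hands cover at most [2 * k] cards, so at least [l >= k] remain. [H] and [K] may overlap or
    coincide. *)
Lemma exists_third_hand H K : (k <= l)%N -> #|H| = k -> #|K| = k ->
  exists L : {set _}, [/\ #|L| = k, [disjoint H & L] & [disjoint K & L]].
Proof.
move=> kl cH cK.
have [|L LHK cL] := @exists_subset_card _ (~: (H :|: K)) k.
  rewrite -(leq_add2l #|H :|: K|) cardsC card_ord.
  rewrite leq_add // cardsU; apply: leq_trans (leq_subr _ _) _.
  by rewrite cH cK addnn mul2n.
exists L; rewrite ![[disjoint _ & L]]disjoint_sym !disjoints_subset.
by move: LHK; rewrite setCU subsetI => /andP[].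
Qed.

(** One hand [H] of [x] is compatible with two disjoint hands [K] and [L] of the other player; these
    differ because they are nonempty. *)
Lemma not_fully_informed_RCP x : (0 < k)%N -> (k <= l)%N -> x <> Cath ->
  ~ fully_informed x (RCP k l).
Proof.
move=> k0 kl xC inf.
have [y yC xy] : exists2 y, y <> Cath & x <> y.
  by case: x xC {inf} => // _; [exists Bill | exists Anne].
have [H cH] := exists_hand.
have [K [cK HK _]] := exists_third_hand kl cH cH.
have [L [cL HL KL]] := exists_third_hand kl cH cK.
have [d [dH dK]] := exists_deal xC yC xy cH cK HK.
have [e [eH eL]] := exists_deal xC yC xy cH cL HL.
have de : e = d by apply: inf; rewrite /= dH eH.
by move: KL; rewrite -dK -eL de -setI_eq0 setIid -cards_eq0 card_hand // eqn0Ngt k0.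
Qed.

Lemma announce_reveals_hand (f : announcement (RCP k l)) y d e :
  (k <= l)%N -> speaker f <> Cath -> y <> Cath -> speaker f <> y ->
  fully_informed y (update f) ->
  announce f d = announce f e -> hand d (speaker f) = hand e (speaker f).
Proof.
move=> kl xC yC xy inf fde.
have [cd ce] := (card_hand d xC, card_hand e xC).
have [K [cK dK eK]] := exists_third_hand kl cd ce.
(* Giving [y] the same hand [K] in both deals leaves the speaker's hands, hence her messages,
   unchanged. *)
have [d' [d'x d'y]] := exists_deal xC yC xy cd cK dK.
have [e' [e'x e'y]] := exists_deal xC yC xy ce cK eK.
have fd : announce f d' = announce f d by apply: announce_known.
have fe : announce f e' = announce f e by apply: announce_known.
have /inf/(congr1 (fun u => (sval u).1)) /= de' :
    indist y (updated_state f d') (updated_state f e').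
  by split; rewrite /= ?d'y ?e'y // fd fe.
by rewrite -d'x -e'x de'.
Qed.

Lemma no_two_announcements (p : protocol (RCP k l)) :
  (0 < k)%N -> (k <= l)%N ->
  announcements p = 2%N -> silent Cath p -> ~ solves p.
Proof.
move=> k0 kl; case: p => [//|f [//|g [|//]]] _ /= [xC [yC _]] [inf safe_fg].
have informed n : n <> Cath -> fully_informed n (update g).
  by move=> nC s t; apply: inf; case: n nC; auto.
have inf_y : fully_informed (speaker g) (update f).
  exact/fully_informed_speaker/informed.
(* A single speaker would already know the whole deal before both announcements. *)
have xy : speaker f <> speaker g.
  move=> xy; apply: (not_fully_informed_RCP k0 kl xC).
  by apply: fully_informed_speaker; rewrite xy.
have [H cH] := exists_hand.
have [K [cK HK _]] := exists_third_hand kl cH cH.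
have [d _] := exists_deal xC yC xy cH cK HK.
have [i ix] : exists i, i \in hand d (speaker f).
  by apply/set0Pn; rewrite -card_gt0 card_hand.
have iC : ~ i \in hand d Cath.
  by move=> iC; have /disjointFr/(_ ix) := disjoint_hand d xC; rewrite iC.
(* Safety lets Cath imagine card [i] of the first speaker in the hand of the second. But [t] shares
   the first message with [d], so the first speaker holds [i] there too. *)
have [t dt iy] : exists2 t, indist Cath (updated_state g (updated_state f d)) t &
    holds t (speaker g) i.
  have := safe_fg (updated_state g (updated_state f d)) i iC.
  by case: (speaker g) yC => // _ [].
have dx := announce_reveals_hand kl xC yC xy inf_y
  (announce_indist_update (proj1 dt)).
have /disjointFr := disjoint_hand (sval (sval t).1).1 xy.
by move=> /(_ i); rewrite -dx => /(_ ix); rewrite iy.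
Qed.

End Deals.

Theorem theorem2 (R : realType) (k l : nat) (hk : (2 <= k)%N)
    (hl : 2 * k%:R ^+ 2 / ln (k%:R : R) <= l%:R) :
  ~ exists p : protocol (RCP k l),
      [/\ announcements p = 2%N, silent Cath p & solves p].
Proof.
have k0 : (0 < k)%N by apply: ltnW.
case=> p [p2 pC]; apply: no_two_announcements => //.
(* It remains to see [k <= 2 * k ^ 2 / ln k]. As [ln k > 0] for [k >= 2], this amounts to
   [ln k <= 2 * k]. *)
rewrite -(ler_nat R); apply: le_trans hl.
have k1 : (1 : R) < k%:R by rewrite ltr1n.
have k0R : (0 : R) < k%:R by rewrite ltr0n.
rewrite ler_pdivlMr ?ln_gt0 // expr2 mulrCA ler_pM2l //.
apply: (@le_trans _ _ k%:R); first exact/ltW/ln_sublinear.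
by rewrite ler_peMl ?ler1n // ltW.
Qed.
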